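(* Let $G$ be a graph, $A\in\mathcal{S}(G)$, $q_j=q_j(A)$, and let $t$ be a positive integer. Then (i) $\sum_{j=1}^t q_j\ge\operatorname{RL}(t)$, and (ii) $q(G)\ge\left\lceil\frac{\operatorname{RL}(t)}{t}\right\rceil$.
   Context: $G$ is a simple graph on vertex set $\{1,\dots,n\}$. $\mathcal{S}(G)$ is the set of real symmetric $n\times n$ matrices $A=[a_{ij}]$ with $a_{ij}\ne0$ iff $ij\in E(G)$ for $i\ne j$ (diagonal unrestricted). For $A\in\mathcal{S}(G)$, $q_j(A)$ is the number of distinct eigenvalues of $A$ of multiplicity at least $j$, $q(A)=q_1(A)$, and $q(G)=\min\{q(A):A\in\mathcal{S}(G)\}$. A linkage in $G$ is a subgraph whose components are paths (a single vertex counts as a path); its order is its number of paths. For $\alpha,\beta\subseteq V(G)$, a linkage is an $(\alpha,\beta)$-linkage if $\alpha$ consists of one endpoint of each path and $\beta$ of the other endpoints (a one-vertex path has its vertex in both); it is rigid if, for some such $\alpha,\beta$, it is the unique $(\alpha,\beta)$-linkage in $G$. The rigid linkage number $\operatorname{RL}(t)=\operatorname{RL}_G(t)$ is the maximum number of vertices in a rigid linkage of order $t$ in $G$. *)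

(* Defs.v *)
From mathcomp Require Import all_boot all_order all_algebra.
From mathcomp Require Import finmap.
From mathcomp Require Import boolp classical_sets cardinality reals.

Set Implicit Arguments.
Unset Strict Implicit.
Unset Printing Implicit Defensive.

Import Order.TTheory GRing.Theory Num.Theory.
Local Open Scope ring_scope.

Record sgraph (n : nat) := SGraph {
  adj : rel 'I_n;
  adj_sym : symmetric adj;
  adj_irr : irreflexive adj
}.

Definition edges n (G : sgraph n) : {set {set 'I_n}} :=
  [set [set u; v] | u in 'I_n, v in 'I_n & adj G u v].

Definition inS (R : realType) n (G : sgraph n) (A : 'M[R]_n) : Prop :=
  A^T = A /\ forall i j, i != j -> (A i j != 0) = adj G i j.

(* Multiplicity is algebraic; for a symmetric matrix it agrees with the
   dimension of the eigenspace. *)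
Definition eigenvalues_mult_ge (R : realType) n (j : nat) (A : 'M[R]_n)
    : classical_sets.set R :=
  [set a : R | eigenvalue A a /\ (j <= mup a (char_poly A))%N]%classic.

(* fset_set returns the empty set on infinite sets; this never happens here. *)
Lemma finite_eigenvalues (R : realType) n j (A : 'M[R]_n) :
  finite_set (eigenvalues_mult_ge j A).
Proof.
have p0 : char_poly A != 0 by rewrite -lead_coef_eq0 (eqP (char_poly_monic A)) oner_eq0.
have [s Hs] : exists s : seq R, forall a, root (char_poly A) a -> a \in s.
  elim: (size (char_poly A)) {-2}(char_poly A) (leqnn (size (char_poly A))) p0
      => [|k IH] p.
    by rewrite leqn0 size_poly_eq0 => ->.
  move=> sp p0; have [[a ra]|nr] := pselect (exists a, root p a); last first.
    by exists [::] => a ra; case: nr; exists a.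
  have /factor_theorem [r pE] := ra.
  have r0 : r != 0 by apply: contraNneq p0 => r0; rewrite pE r0 mul0r.
  have sr : (size r <= k)%N.
    by move: sp; rewrite pE size_Mmonic ?monicXsubC// size_XsubC addn2.
  have [s Hs] := IH _ sr r0.
  exists (a :: s) => b; rewrite pE rootM root_XsubC inE orbC.
  by case/orP => [->//|/Hs ->]; rewrite orbT.
apply: (@sub_finite_set _ _ [set` s]%classic); last exact: finite_seq.
by move=> a /= [+ _]; rewrite eigenvalue_root_char => /Hs.
Qed.

Definition q_ (R : realType) n (j : nat) (A : 'M[R]_n) : nat :=
  #|` fset_set (eigenvalues_mult_ge j A) |%fset.

Definition q_mx (R : realType) n (A : 'M[R]_n) : nat := q_ 1 A.

Lemma inS_ex (R : realType) n (G : sgraph n) : exists A : 'M[R]_n, inS G A.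
Proof.
exists (\matrix_(i, j) (adj G i j)%:R); split.
  by apply/matrixP => i j; rewrite !mxE adj_sym.
by move=> i j _; rewrite mxE; case: (adj G i j); rewrite ?oner_eq0 ?eqxx.
Qed.

Lemma q_mx_ex (R : realType) n (G : sgraph n) :
  exists k, `[< exists2 A : 'M[R]_n, inS G A & q_mx A = k >].
Proof.
by have [A HA] := inS_ex R G; exists (q_mx A); apply/asboolP; exists A.
Qed.

Definition q_graph (R : realType) n (G : sgraph n) : nat :=
  ex_minn (q_mx_ex R G).

(* A pair of a vertex set and a set of edges, each edge being a set of two
   vertices. *)
Definition subgraph (n : nat) : Type := ({set 'I_n} * {set {set 'I_n}})%type.

Definition vset n (H : subgraph n) : {set 'I_n} := H.1.
Definition eset n (H : subgraph n) : {set {set 'I_n}} := H.2.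

Definition is_subgraph n (G : sgraph n) (H : subgraph n) : Prop :=
  eset H \subset edges G /\ finset.cover (eset H) \subset vset H.

Definition components n (H : subgraph n) : {set {set 'I_n}} :=
  equivalence_partition
    (connect [rel u v | [set u; v] \in eset H]) (vset H).

Definition path_edges n (p : seq 'I_n) : {set {set 'I_n}} :=
  [set [set uv.1; uv.2] | uv in zip p (behead p)].

(* The component of H with vertex set C is a path with endpoints a and b. *)
Definition is_path n (H : subgraph n) (C : {set 'I_n}) (a b : 'I_n) : Prop :=
  exists p : seq 'I_n,
    [/\ uniq (a :: p), last a p = b, C = [set x in a :: p]
      & [set f in eset H | f \subset C] = path_edges (a :: p)].

Definition is_linkage n (G : sgraph n) (H : subgraph n) : Prop :=
  is_subgraph G H /\
  forall C, C \in components H -> exists a b, is_path H C a b.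

Definition order_linkage n (H : subgraph n) : nat := #|components H|.

(* The functions a and b choose, for each path, which endpoint goes in alpha
   and which one in beta. *)
Definition is_ab_linkage n (G : sgraph n) (alpha beta : {set 'I_n})
    (H : subgraph n) : Prop :=
  is_linkage G H /\
  exists a b : {set 'I_n} -> 'I_n,
    [/\ forall C, C \in components H -> is_path H C (a C) (b C),
        alpha = [set a C | C in components H]
      & beta = [set b C | C in components H]].

Definition is_rigid n (G : sgraph n) (H : subgraph n) : Prop :=
  exists alpha beta : {set 'I_n},
    is_ab_linkage G alpha beta H /\
    forall H', is_ab_linkage G alpha beta H' -> H' = H.

(* A maximum over the empty set, hence 0, when G has no rigid linkage of order t, that is, when t > n. *)
Definition RL n (G : sgraph n) (t : nat) : nat :=
  \max_(H : subgraph n | `[< is_rigid G H /\ order_linkage H = t >]) #|vset H|.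

(* Main.v *)
Require Import Defs.
From mathcomp Require Import all_boot all_order all_algebra.
From mathcomp Require Import fingroup perm finmap boolp reals.
From mathcomp Require cardinality.
From mathcomp Require Import zify.
From mathcomp Require Import complex.

(* Let H be the unique (alpha, beta)-linkage on its endpoints, with t paths, and
   let s0 be the permutation that moves along each path of H from alpha to beta,
   sends the end of each path back to its start, and fixes the other vertices.
   Replace each row u in beta of xI - A by the unit row supported at s0 u. A
   permutation s contributing to the determinant of the result traces, starting
   from alpha, an (alpha, beta)-linkage, which must be H; hence s agrees with s0
   on V(H), and the determinant has degree exactly n - |V(H)|. If lambda is an
   eigenvalue of A of multiplicity m, the altered matrix has nullity at least
   m - t at lambda, so (x - lambda)^(m - t) divides its determinant. Summing the
   truncated differences m - t over the eigenvalues gives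
   n - |V(H)| >= sum (m - t) = n - sum min(m, t) = n - (q_1 + ... + q_t). *)

Set Implicit Arguments.
Unset Strict Implicit.
Unset Printing Implicit Defensive.

Import Order.TTheory GRing.Theory Num.Theory.
Local Open Scope ring_scope.

(** * Root multiplicities of determinants, and ranks *)

Lemma sum_mup_le_deg (F : fieldType) (p : {poly F}) (s : seq F) :
  p != 0 -> uniq s -> (\sum_(x <- s) mup x p <= (size p).-1)%N.
Proof.
elim: s p => [|x s IHs] p p0 /=; first by rewrite big_nil.
case/andP=> xs us; have [m [q]] := multiplicity_XsubC p x.
rewrite p0 /= => qx pE.
have q0 : q != 0 by apply: contraNneq p0 => q0; rewrite pE q0 mul0r.
(* Removing the full power of X - x changes the multiplicity at x only, so [q] serves for the
   remaining points of [s]. *)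
have mE y : mup y p = (mup y q + if x == y then m else 0)%N.
  by rewrite pE mupM ?mup_XsubCX // expf_neq0 ?polyXsubC_eq0.
rewrite big_cons mE eqxx mupNroot // add0n.
rewrite (eq_big_seq (fun y => mup y q)) => [|y ys]; last first.
  by rewrite mE; case: eqP => [xy|_]; rewrite ?addn0 //; rewrite xy ys in xs.
rewrite pE size_Mmonic ?monicX ?monic_exp ?monicXsubC // size_exp_XsubC.
rewrite addnS /= addnC -[size q]prednK ?size_poly_gt0 // addSn /= leq_add2r.
exact: IHs.
Qed.

(* After a constant change of basis, the last n - rank rows of M vanish at x. *)
Lemma rank_horner_dvd_det (F : fieldType) n (M : 'M[{poly F}]_n) (x : F) :
  ('X - x%:P) ^+ (n - \rank (map_mx (horner_eval x) M)) %| \det M.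
Proof.
set N := map_mx _ M; set r := \rank N.
pose L := invmx (col_ebase N).
have Lu : \det (map_mx (@polyC F) L) != 0.
  by rewrite det_map_mx polyC_eq0 -unitfE -unitmxE unitmx_inv col_ebase_unit.
rewrite -(@Gauss_dvdpr _ _ (\det (map_mx (@polyC F) L))); last first.
  rewrite det_map_mx in Lu *; rewrite polyC_eq0 in Lu.
  by rewrite -[X in coprimep _ X]alg_polyC coprimepZr // coprimep1.
rewrite -det_mulmx; set P := _ *m M.
have Proot (i j : 'I_n) : (r <= i)%N -> 'X - x%:P %| P i j.
  move=> ri; rewrite dvdp_XsubCl /root.
  have -> : (P i j).[x] = (L *m N) i j.
    rewrite !mxE horner_sum; apply: eq_bigr => k _.
    by rewrite !mxE hornerM hornerC.
  (* [N] factors as [col_ebase N] times [pid_mx r] times [row_ebase N]; cancelling the first factor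
     leaves zero rows from index [r] on. *)
  rewrite -[N]mulmx_ebase /L mulmxA mulmxA mulVmx ?col_ebase_unit // mul1mx.
  rewrite -/r mxE big1 // => k _; rewrite !mxE ltnNge ri andbF mul0r //.
rewrite /determinant.
apply: (big_ind (fun p => _ %| p)) => [|p q|s _]; [exact: dvdp0 | exact: dvdp_add|].
rewrite dvdp_mull //.
(* Each Leibniz term has n - r factors from the rows i >= r, all divisible by X - x. *)
rewrite (bigID (fun i : 'I_n => (r <= i)%N)) /= dvdp_mulr //.
have -> : (n - r)%N = #|[pred i : 'I_n | (r <= i)%N]|.
  by rewrite -sum1_card -(big_geq_mkord _ _ predT (fun=> 1%N)) sum_nat_const_nat muln1.
rewrite -prodr_const.
by apply: (big_ind2 (fun p q => p %| q)) => [|p p' q q' pq pq'|i /Proot];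
  rewrite ?dvdp_mul.
Qed.

(** [M] is the sum of its single-row parts over [B], each of rank at most 1. *)
Lemma rank_le_nonzero_rows (F : fieldType) m n (M : 'M[F]_(m, n))
    (B : {set 'I_m}) :
  (forall i j, i \notin B -> M i j = 0) -> (\rank M <= #|B|)%N.
Proof.
move=> MB; have -> : M = \sum_(i in B) delta_mx i i *m M.
  have E k i j : (delta_mx k k *m M) i j = if i == k then M i j else 0.
    rewrite mxE (bigD1 k) //= big1 ?addr0 => [|l lk].
      by rewrite mxE eqxx andbT; case: eqP => [->|_]; rewrite ?mul1r ?mul0r.
    by rewrite mxE (negPf lk) andbF mul0r.
  apply/matrixP => i j; rewrite summxE (eq_bigr _ (fun k _ => E k i j)).
  rewrite -big_mkcondr /=; have [iB|iB] := boolP (i \in B).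
    rewrite (big_pred1 i) // => k; rewrite /= eq_sym andbC.
    by case: eqP => // ->.
  rewrite MB // big_pred0 // => k.
  by case: eqP => [<-|]; rewrite ?andbF // (negPf iB).
rewrite -sum1_card.
elim/big_rec2: _ => [|i k S _ IH]; first by rewrite mxrank0.
apply: leq_trans (mxrank_add _ _) _; rewrite leq_add //.
by apply: leq_trans (mxrankM_maxl _ _) _; rewrite mxrank_delta.
Qed.

(** * Spectrum of a real symmetric matrix *)

(** Over [R[i]] the matrix is hermitian, hence diagonalizable with real diagonal entries; the
    characteristic polynomial and the ranks are then carried back to [R]. The last clause says that
    the geometric multiplicity of x is at least its number of occurrences in [s]. *)
Lemma realsym_spectrum (R : rcfType) n (A : 'M[R]_n) : A^T = A ->
  exists s : seq R, [/\ size s = n, char_poly A = \prod_(y <- s) ('X - y%:P)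
    & forall x, (\rank (x%:M - A)%R + count_mem x s <= n)%N].
Proof.
move=> As; pose f : {rmorphism R -> R[i]} := real_complex R.
pose B := map_mx f A.
have Br : B \is a mxOver Num.real.
  by apply/mxOverP => i j; rewrite mxE; apply/complex_realP; exists (A i j).
have Bs : B \is symmetricmx.
  by apply/is_hermitianmxP; rewrite expr0 scale1r; apply/matrixP => i j;
    rewrite !mxE -{1}As mxE.
have Bh := realsym_hermsym Bs Br.
have /orthomx_spectralP := hermitian_normalmx Bh.
have := spectral_unit B; have := hermitian_spectral_diag_real Bh.
move: (spectralmx B) (spectral_diag B) => P D /mxOverP Dr Pu BE.
have [d dE] : exists d : 'I_n -> R, forall i, D 0 i = f (d i).
  exists (fun i => complex.Re (D 0 i)) => i.
  by have /complex_realP [y ->] := Dr 0 i.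
have DE : diag_mx D = map_mx f (diag_mx (\row_i d i)).
  by apply/matrixP => i j; rewrite !mxE dE rmorphMn.
exists [seq d i | i <- enum 'I_n]; split; first by rewrite size_map size_enum_ord.
  rewrite big_map big_enum; apply: (map_poly_inj f); rewrite map_char_poly -/B.
  transitivity (char_poly (diag_mx D)).
    rewrite /char_poly /char_poly_mx BE !map_mxM map_invmx.
    set Q := map_mx _ P.
    have Qu : Q \in unitmx by rewrite map_unitmx.
    have XE : 'X%:M = invmx Q *m 'X%:M *m Q.
      by rewrite -mulmxA -scalar_mxC mulKmx.
    rewrite [in LHS]XE -mulmxBl -mulmxBr !det_mulmx mulrAC -det_mulmx.
    by rewrite mulVmx // det1 mul1r.
  rewrite DE -map_char_poly; congr (map_poly _ _).
  rewrite char_poly_trig ?diag_mx_is_trig //.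
  by apply: eq_bigr => i _; rewrite !mxE eqxx mulr1n.
move=> x; rewrite -(mxrank_map f) map_mxB map_scalar_mx -/B.
have -> : (f x)%:M - B = invmx P *m ((f x)%:M - diag_mx D) *m P.
  by rewrite mulmxBr mulmxBl -BE -mulmxA -scalar_mxC mulKmx.
rewrite mxrankMfree ?row_free_unit // eqmxMfull ?row_full_unit ?unitmx_inv //.
(* The indices with [d i = x] give the multiplicity; the others are the only possibly nonzero rows
   of the diagonal matrix. *)
rewrite count_map -sum1_count big_enum_cond.
rewrite -[X in (_ <= X)%N]card_ord -(cardC [pred i | d i == x]) addnC.
rewrite sum1_card leq_add2l -(cardsE (predC _)).
apply: rank_le_nonzero_rows => i j; rewrite !inE negbK => /eqP dix.
by rewrite !mxE dE dix; case: eqP => _; rewrite ?mulr1n ?mulr0n subrr.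
Qed.

(** * Edge sets of paths *)

Lemma path_edges1 n (x : 'I_n) : path_edges [:: x] = set0.
Proof. by apply/setP => f; rewrite inE; apply/imsetP => -[]. Qed.

Lemma path_edges_cons n (x y : 'I_n) p :
  path_edges [:: x, y & p] = [set x; y] |: path_edges (y :: p).
Proof.
apply/setP => f; rewrite !inE; apply/imsetP/orP => /= [[uv]|].
  rewrite inE => /orP[/eqP -> -> /=|h ->]; first by rewrite eqxx; left.
  by right; apply: imset_f.
case=> [/eqP ->|/imsetP[uv h ->]]; first by exists (x, y); rewrite ?mem_head.
by exists uv; rewrite // inE h orbT.
Qed.

Lemma path_edgesW n (P : rel 'I_n) (E : {set {set 'I_n}}) x p :
  (forall u v, [set u; v] \in E -> P u v) ->
  path_edges (x :: p) \subset E -> path P x p.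
Proof.
move=> EP; elim: p x => //= y p IH x; rewrite path_edges_cons subUset sub1set.
by case/andP=> /EP -> /IH.
Qed.

Lemma path_edges_sub n (E : {set {set 'I_n}}) x p :
  path (fun u v => [set u; v] \in E) x p -> path_edges (x :: p) \subset E.
Proof.
elim: p x => [|y p IH] x /=; first by rewrite path_edges1 sub0set.
by case/andP=> xy /IH; rewrite path_edges_cons subUset sub1set xy.
Qed.

Lemma mem_edges n (G : sgraph n) u v : ([set u; v] \in edges G) = adj G u v.
Proof.
apply/imset2P/idP => [[x y _] /[!inE] /= xy E|uv]; last first.
  by exists u v; rewrite ?inE.
have nxy : x != y by apply: contraTneq xy => ->; rewrite adj_irr.
have := set21 x y; have := set22 x y; rewrite -E !inE.
case/orP=> /eqP ? /orP[]/eqP ?; subst x y; rewrite ?eqxx // in nxy *.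
by rewrite adj_sym.
Qed.

(** That [f] is nonempty matters later: a vertex of [f] decides which of several disjoint paths the
    edge belongs to. *)
Lemma path_edges_vertices n (x : 'I_n) p f :
  f \in path_edges (x :: p) -> f \subset x :: p /\ exists z, z \in f.
Proof.
elim: p x => [|y p IH] x; first by rewrite path_edges1 inE.
rewrite path_edges_cons !inE => /orP[/eqP ->|/IH[fp zf]].
  split; last by exists x; rewrite !inE eqxx.
  by apply/subsetP => z; rewrite !inE => /orP[]->; rewrite ?orbT.
split=> //; apply/subsetP => z /(subsetP fp).
by rewrite [z \in x :: _]inE orbC => ->.
Qed.

(** As [x] does not recur, the first edge is the only one containing [x]. It determines the second
    vertex, and deleting it from both edge sets allows induction. *)
Lemma path_edges_inj n (x : 'I_n) p q :
  uniq (x :: p) -> uniq (x :: q) ->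
  path_edges (x :: p) = path_edges (x :: q) -> p = q.
Proof.
have headE y z (r : seq 'I_n) : x \notin z :: r ->
    [set x; y] \in path_edges (z :: r) -> False.
  move=> xr /path_edges_vertices[/subsetP/(_ x)].
  by rewrite set21 (negPf xr) => /(_ isT).
elim: p x q headE => [|y p IH] x [|z q] headE //.
- by rewrite path_edges1 path_edges_cons => _ _ /setP/(_ [set x; z]); rewrite !inE eqxx.
- by rewrite path_edges1 path_edges_cons => _ _ /setP/(_ [set x; y]); rewrite !inE eqxx.
move=> /andP[xp up] /andP[xq uq]; rewrite !path_edges_cons => E.
have yz : y = z.
  have /setU1P[E2|/headE -/(_ xq)//] :
      [set x; y] \in [set x; z] |: path_edges (z :: q).
    by rewrite -E setU11.
  have := set22 x y; rewrite E2 !inE => /orP[]/eqP // yx.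
  by rewrite yx mem_head in xp.
subst z; congr cons; apply: (IH y) => //.
  move=> z w r yr /path_edges_vertices[/subsetP/(_ y)].
  by rewrite set21 (negPf yr) => /(_ isT).
have /setU1K <- : [set x; y] \notin path_edges (y :: p).
  by apply/negP => /headE; apply.
have /setU1K <- : [set x; y] \notin path_edges (y :: q).
  by apply/negP => /headE; apply.
by rewrite E.
Qed.

(** * Linkages built from disjoint paths *)

Lemma components_partition n (H : subgraph n) :
  partition (components H) (vset H).
Proof.
apply: equivalence_partitionP => x y z _ _ _; split; first exact: connect0.
move=> xy; apply: same_connect xy z; apply: sym_connect_sym => u v /=.
by rewrite setUC.
Qed.

(* The path starting at x in alpha is x :: p x. *)
Definition disjoint_paths n (alpha : {set 'I_n}) (p : 'I_n -> seq 'I_n) : Prop :=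
  {in alpha & , forall x y z, z \in x :: p x -> z \in y :: p y -> x = y}.

Definition paths_union n (alpha : {set 'I_n}) (p : 'I_n -> seq 'I_n) : subgraph n :=
  (\bigcup_(x in alpha) [set z in x :: p x],
   \bigcup_(x in alpha) path_edges (x :: p x)).

(** By disjointness, an edge of the union that touches a path belongs to that path. Hence the vertex
    set of each path is closed under adjacency, and it is connected by the path itself. *)
Lemma components_paths_union n (alpha : {set 'I_n}) p :
  disjoint_paths alpha p ->
  components (paths_union alpha p) = [set [set z in x :: p x] | x in alpha].
Proof.
move=> dis; set H := paths_union alpha p.
set e := [rel u v | [set u; v] \in eset H].
have esym : connect_sym e.
  by apply: sym_connect_sym => u v /=; rewrite setUC.
have cl x : x \in alpha -> closed e [pred z in x :: p x].
  move=> xa; apply: (intro_closed esym) => u v /bigcupP[y ya uv].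
  rewrite -!topredE /= => ux; have [/subsetP sub _] := path_edges_vertices uv.
  by rewrite (dis _ _ xa ya u ux) ?sub ?set21 ?set22.
have co x u : x \in alpha -> u \in x :: p x -> connect e x u.
  move=> xa; apply: path_connect.
  by apply: (path_edgesW (E := eset H)) => //; apply: bigcup_sup.
have cE x u : x \in alpha -> u \in x :: p x ->
    [set y in vset H | connect e u y] = [set z in x :: p x].
  move=> xa ux; apply/setP => y; rewrite [LHS]inE; apply/andP/idP => [[_ uy]|yx].
    rewrite in_set.
    have <- : (u \in x :: p x) = (y \in x :: p x) := closed_connect (cl x xa) uy.
    by [].
  split; first by apply/bigcupP; exists x.
  move: yx; rewrite in_set => yx.
  by apply: (@connect_trans _ e x); [rewrite esym; apply: co | apply: co].
apply/setP => C; apply/imsetP/imsetP => [[u /bigcupP[x xa]]|[x xa ->]].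
  by rewrite in_set => ux ->; exists x => //; apply: cE.
exists x; last by rewrite (cE x) ?mem_head.
by apply/bigcupP; exists x; rewrite // inE mem_head.
Qed.

Lemma path_edges_paths_union n (alpha : {set 'I_n}) p x :
  disjoint_paths alpha p -> x \in alpha ->
  [set f in eset (paths_union alpha p) | f \subset [set z in x :: p x]] =
    path_edges (x :: p x).
Proof.
move=> dis xa.
apply/setP => f; rewrite inE; apply/andP/idP => [[/bigcupP[y ya fy] fx]|fx].
  have [/subsetP sub [z zf]] := path_edges_vertices fy.
  rewrite (dis _ _ xa ya z) ?sub //.
  by have := subsetP fx z zf; rewrite in_set.
split; first by apply/bigcupP; exists x.
have [/subsetP sub _] := path_edges_vertices fx.
by apply/subsetP => z /sub; rewrite in_set.
Qed.

(* x0 is only a default value for the endpoint functions of is_ab_linkage. *)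
Lemma disjoint_paths_linkage n (G : sgraph n) (alpha : {set 'I_n}) p (x0 : 'I_n) :
  disjoint_paths alpha p ->
  {in alpha, forall x, uniq (x :: p x)} ->
  {in alpha, forall x, path (adj G) x (p x)} ->
  is_ab_linkage G alpha [set last x (p x) | x in alpha] (paths_union alpha p).
Proof.
move=> dis up gp; set H := paths_union alpha p.
have cH := components_paths_union dis.
have isp x : x \in alpha -> is_path H [set z in x :: p x] x (last x (p x)).
  move=> xa; exists (p x); split => //; first exact: up.
  exact: path_edges_paths_union.
(* A path meets [alpha] only in its start, so picking a vertex of [alpha] in a component recovers
   the start. *)
have hd x : x \in alpha -> [pick y in alpha | y \in [set z in x :: p x]] = Some x.
  move=> xa; case: pickP => [y /andP[ya]|/(_ x)]; rewrite in_set.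
    by move=> yx; rewrite (dis _ _ xa ya y) // mem_head.
  by rewrite xa mem_head.
split.
  split; last first.
    move=> C; rewrite cH => /imsetP[x xa ->].
    by exists x, (last x (p x)); apply: isp.
  split.
    apply/bigcupsP => x xa; apply: path_edges_sub.
    by apply: sub_path (gp x xa) => u v; rewrite mem_edges.
  apply/bigcupsP => f /bigcupP[x xa fx]; apply/subsetP => z zf.
  have [/subsetP sub _] := path_edges_vertices fx.
  by apply/bigcupP; exists x => //; rewrite inE sub.
pose a C := odflt x0 [pick y in alpha | y \in (C : {set 'I_n})].
exists a, (fun C => last (a C) (p (a C))); rewrite cH; split.
- by move=> C /imsetP[x xa ->]; rewrite /a hd //; apply: isp.
- rewrite -imset_comp (eq_in_imset (g := id)) ?imset_id // => x xa /=.
  by rewrite /a hd.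
- by rewrite -imset_comp; apply: eq_in_imset => x xa /=; rewrite /a hd.
Qed.

(** * Linkages traced by a permutation *)

(** The predecessor of [x] under [s] lies in [beta] and on the orbit of [x], so [beta] is reached
    before the orbit closes up, and no vertex is repeated until then. *)
Lemma first_hit (T : finType) (s : {perm T}) (alpha beta : {set T}) :
  (forall u, (s u \in alpha) = (u \in beta)) ->
  exists k : T -> nat, {in alpha, forall x,
    [/\ uniq (traject s x (k x).+1), iter (k x) s x \in beta
      & forall i, (i < k x)%N -> iter i s x \notin beta]}.
Proof.
move=> sab; exists (fun x => find (mem beta) (orbit s x)) => x xa.
have hasb : has (mem beta) (orbit s x).
  apply/hasP; exists ((s^-1)%g x); last by rewrite /= -sab permKV.
  rewrite -fconnect_orbit (fconnect_sym (@perm_inj _ s)).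
  by rewrite -{2}(permKV s x) fconnect1.
have kx : (find (mem beta) (orbit s x) < fingraph.order s x)%N.
  by rewrite -[ltnRHS](size_orbit s) -has_find.
split.
- by rewrite -(take_traject _ _ kx) take_uniq // orbit_uniq.
- by have := nth_find x hasb; rewrite nth_traject.
- move=> i ik; have := before_find x ik; rewrite nth_traject ?(ltn_trans ik) //.
  by move/negbT.
Qed.

(* If two trajectories meet, one start lies on the trajectory of the other; were
   it not its start, its predecessor would be an earlier visit to beta. *)
Lemma disjoint_first_hits n (s : {perm 'I_n}) (alpha beta : {set 'I_n}) k :
  (forall u, (s u \in alpha) = (u \in beta)) ->
  {in alpha, forall x i, (i < k x)%N -> iter i s x \notin beta} ->
  disjoint_paths alpha (fun x => traject s (s x) (k x)).
Proof.
move=> sab kb.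
have main x y i j : x \in alpha -> y \in alpha -> (i <= j <= k y)%N ->
    iter i s x = iter j s y -> x = y.
  move=> xa ya /andP[ij jk]; rewrite -(subnKC ij) iterD.
  have inj : injective (iter i s) by elim: (i) => //= m IH u v /perm_inj/IH.
  move/inj; case E : (j - i)%N => [//|m] xE.
  have : iter m s y \in beta by rewrite -sab -iterS -xE.
  by rewrite (negPf (kb y ya m _)) // (leq_trans _ jk) // -E leq_subr.
move=> x y z xa ya; rewrite -!trajectS.
case/trajectP=> i ik -> /trajectP[j jk E].
have [ij|/ltnW ji] := leqP i j; first by apply: (main x y i j); rewrite ?ij.
by apply/esym; apply: (main y x j i); rewrite ?ji.
Qed.

(** Each start in [alpha] is followed under [s] until the first visit to [beta]. No vertex repeats
    on the way, so no step is a fixed point and every step is an edge. Cycles of [s] avoiding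
    [alpha] are left out of the linkage. *)
Lemma first_hit_linkage n (G : sgraph n) (s : {perm 'I_n})
    (alpha beta : {set 'I_n}) (x0 : 'I_n) :
  (forall u, (s u \in alpha) = (u \in beta)) ->
  (forall u, u \notin beta -> s u = u \/ adj G u (s u)) ->
  exists p : 'I_n -> seq 'I_n, [/\ disjoint_paths alpha p,
    {in alpha, forall x, uniq (x :: p x) /\ fpath s x (p x)}
    & is_ab_linkage G alpha beta (paths_union alpha p)].
Proof.
move=> sab sG; have [k kP] := first_hit sab.
pose p x := traject s (s x) (k x); exists p.
have dis : disjoint_paths alpha p.
  by apply: disjoint_first_hits sab _ => x /kP[].
have up : {in alpha, forall x, uniq (x :: p x)} by move=> x /kP[].
have lastp x : last x (p x) = iter (k x) s x.
  exact: last_traject.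
split=> //.
  by move=> x xa; split; [exact: up | exact: fpath_traject].
have -> : beta = [set last x (p x) | x in alpha].
  (* The ends lie in [beta] and are distinct by disjointness; [beta], the preimage of [alpha] under
     [s], is exactly as large as [alpha]. *)
  apply/esym/eqP; rewrite eqEcard; apply/andP; split.
    by apply/subsetP => _ /imsetP[x /kP[_ kb _] ->]; rewrite lastp.
  have -> : beta = s @^-1: alpha by apply/setP => u; rewrite inE sab.
  rewrite card_preimset; last exact: perm_inj.
  rewrite card_in_imset // => x y xa ya E.
  by apply: (dis x y xa ya (last x (p x))); rewrite ?mem_last // E mem_last.
apply: disjoint_paths_linkage => // x xa; have [u _ kb] := kP _ xa.
apply/(pathP x) => i; rewrite size_traject => ik.
have nthE j : (j <= k x)%N -> nth x (x :: p x) j = iter j s x.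
  by move=> jk; apply: (@nth_traject _ s j (k x).+1 jk x).
have neq : iter i s x != iter i.+1 s x.
  rewrite -(nthE i (ltnW ik)) -(nthE i.+1 ik) nth_uniq ?up //= ?ltn_eqF //.
    by rewrite ltnS size_traject ltnW.
  by rewrite ltnS size_traject.
rewrite -[nth x (p x) i]/(nth x (x :: p x) i.+1) (nthE i (ltnW ik)) (nthE i.+1 ik).
by case: (sG _ (kb i ik)) => // E; rewrite /= E eqxx in neq.
Qed.

(** * Rigidity as uniqueness of a permutation *)

Lemma next_last (T : eqType) (x : T) p : uniq (x :: p) -> next (x :: p) (last x p) = x.
Proof.
by move=> up; rewrite next_nth mem_last index_last // nth_default.
Qed.

(** [s0] comes from closing each path of [H] into a cycle. A competing [s] also sends exactly [beta]
    into [alpha], so its first-hit paths form a linkage equal to [H] by uniqueness; edge sets then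
    fix the order of the vertices on each path. *)
Lemma rigid_linkage_routing n (G : sgraph n) (H : subgraph n) :
  is_rigid G H -> exists (beta : {set 'I_n}) (s0 : {perm 'I_n}),
  [/\ #|beta| = order_linkage H, beta \subset vset H,
      {in vset H :\: beta, forall u, adj G u (s0 u)},
      (forall u, u \notin vset H -> s0 u = u)
    & forall s : {perm 'I_n}, {in beta, s =1 s0} ->
      (forall u, u \notin beta -> s u = u \/ adj G u (s u)) ->
      {in vset H, s =1 s0}].
Proof.
case=> alpha [beta [[[[HG _] _] [a [b [ab alphaE betaE]]]] Huniq]].
have /and3P[/eqP covH tiH _] := components_partition H.
pose good (C : {set 'I_n}) p := [/\ uniq (a C :: p), last (a C) p = b C,
  C = [set x in a C :: p]
  & [set f in eset H | f \subset C] = path_edges (a C :: p)].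
(* Finite choice fixes one path per component; other sets get the empty list. *)
have [q qP] : exists q, forall C, C \in components H -> good C (q C).
  apply: (@fin_all_exists _ (fun=> seq 'I_n)
            (fun C p => C \in components H -> good C p)) => C.
  have [/ab[p pP]|nC] := boolP (C \in components H); first by exists p.
  by exists [::].
pose cyc C := a C :: q C.
have memC C u : C \in components H -> (u \in cyc C) = (u \in C).
  by case/qP=> _ _ E _; rewrite [in RHS]E in_set.
have blk u : u \in vset H -> pblock (components H) u \in components H.
  by rewrite -covH => /pblock_mem.
have blkE C u : C \in components H -> u \in cyc C -> pblock (components H) u = C.
  by move=> CH; rewrite memC //; apply: def_pblock.
have memb u : u \in vset H -> u \in cyc (pblock (components H) u).
  by move=> uH; rewrite memC ?blk // mem_pblock covH.
have memV C u : C \in components H -> u \in cyc C -> u \in vset H.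
  by move=> CH; rewrite memC // -covH => uC; apply/bigcupP; exists C.
have bcyc C : C \in components H -> b C \in cyc C.
  by move=> /qP[_ <- _ _]; apply: mem_last.
have acyc C : a C \in cyc C by exact: mem_head.
have binj : {in components H &, injective b}.
  move=> C D CH DH E; rewrite -(blkE C (b C)) ?bcyc //.
  by rewrite (blkE D) // E bcyc.
pose nx u := if u \in vset H then next (cyc (pblock (components H) u)) u else u.
have nxE C u : C \in components H -> u \in cyc C -> nx u = next (cyc C) u.
  by move=> CH uC; rewrite /nx (memV C) // (blkE C).
have uC C : C \in components H -> uniq (cyc C) by case/qP.
have nxI : injective nx.
  pose pv u := if u \in vset H then prev (cyc (pblock (components H) u)) u else u.
  apply: (can_inj (g := pv)) => u; rewrite /pv.
  have [uH|uH] := boolP (u \in vset H); last by rewrite /nx (negPf uH) (negPf uH).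
  have CH := blk u uH; set C := pblock _ u in CH.
  have nC : next (cyc C) u \in cyc C by rewrite mem_next memb.
  rewrite (nxE C) ?memb // (memV C) // (blkE C) // prev_next //; exact: uC.
have nxb C : C \in components H -> nx (b C) = a C.
  move=> CH; rewrite (nxE C) ?bcyc //; have [_ <- _ _] := qP C CH.
  exact/next_last/uC.
exists beta, (perm nxI); split.
- by rewrite betaE card_in_imset.
- by rewrite betaE; apply/subsetP => _ /imsetP[C CH ->]; apply: (memV C); rewrite ?bcyc.
- move=> u; rewrite inE => /andP[ub uH]; rewrite permE /nx uH.
  have CH := blk u uH; set C := pblock _ u in CH *.
  (* Every step out of [beta] is allowed, so the closing step from [b C] to [a C] is harmless and
     the whole cycle satisfies [e]. *)
  pose e := [rel u v | (u \in beta) || adj G u v].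
  have cycC : path.cycle e (cyc C).
    have [_ lE _ qE] := qP C CH.
    rewrite /cyc /= rcons_path lE /= betaE imset_f // andbT.
    apply: (path_edgesW (E := edges G)) => [x y|].
      by rewrite mem_edges /= => ->; rewrite orbT.
    by rewrite -qE setIdE; apply: subset_trans HG; apply: subsetIl.
  by have := next_cycle cycC (memb u uH); rewrite /e /= (negPf ub).
- by move=> u uH; rewrite permE /nx (negPf uH).
move=> s sb sG.
have sbC C : C \in components H -> s (b C) = a C.
  by move=> CH; rewrite sb ?permE ?nxb // betaE imset_f.
have sab u : (s u \in alpha) = (u \in beta).
  rewrite alphaE betaE; apply/imsetP/imsetP => -[C CH E]; exists C => //.
    by apply/(@perm_inj _ s); rewrite sbC.
  by rewrite E sbC.
move=> v vH.
have [p [dis up /Huniq HE]] := first_hit_linkage v sab sG.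
have CH := blk v vH; set C := pblock _ v in CH.
have := CH; rewrite -HE components_paths_union // => /imsetP[x xa CE].
have aC : a C \in alpha by rewrite alphaE imset_f.
have ax : a C = x.
  apply: (dis _ _ aC xa (a C)); first exact: mem_head.
  by have := acyc C; rewrite memC // CE in_set.
have [_ _ _ qE] := qP C CH.
have [upx fpx] := up _ aC.
(* Both paths start at [a C] and have the same edges. *)
have qp : q C = p (a C).
  apply: (@path_edges_inj _ (a C)) => //; first exact: uC.
  by rewrite -qE -(path_edges_paths_union dis aC) HE ax -CE.
have cyc_s : fcycle s (cyc C).
  rewrite /cyc qp /= rcons_path fpx /=.
  have [_ E _ _] := qP C CH.
  by rewrite -qp E sbC.
rewrite permE (nxE C) ?memb //.
by apply/eqP; have /= := next_cycle cyc_s (memb v vH).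
Qed.

(** * Degree and roots of the determinant of the altered matrix *)

Definition routing_mx (F : fieldType) n (A : 'M[F]_n) (beta : {set 'I_n})
    (s : {perm 'I_n}) : 'M[{poly F}]_n :=
  \matrix_(u, v) if u \in beta then (v == s u)%:R else char_poly_mx A u v.

(** A nonzero Leibniz term agrees with [s0] on [V], where its factors are constants; outside [V] a
    factor has degree 1 only at a fixed point. Since [s0] fixes everything outside [V], its term
    strictly dominates and cannot cancel. *)
Lemma size_det_routing_mx (F : fieldType) n (A : 'M[F]_n)
    (V beta : {set 'I_n}) (s0 : {perm 'I_n}) :
  beta \subset V ->
  {in V :\: beta, forall u, A u (s0 u) != 0 /\ s0 u != u} ->
  (forall u, u \notin V -> s0 u = u) ->
  (forall s : {perm 'I_n}, {in beta, s =1 s0} ->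
     (forall u, u \notin beta -> s u = u \/ A u (s u) != 0) -> {in V, s =1 s0}) ->
  size (\det (routing_mx A beta s0)) = (n - #|V|).+1.
Proof.
move=> bV s0V s0N s0U; set N := routing_mx A beta s0.
pose T (s : {perm 'I_n}) := \prod_u N u (s u).
have NE u v : u \notin beta -> N u v = 'X *+ (u == v) - (A u v)%:P.
  by move=> ub; rewrite !mxE (negPf ub).
have TV s : T s != 0 -> {in V, s =1 s0}.
  move=> /prodf_neq0 Ts; apply: s0U => u ub; have := Ts u isT.
    by rewrite mxE ub; case: (s u =P s0 u) => //= _; rewrite eqxx.
  rewrite NE //; case: (u =P s u) => [<-|_]; first by left.
  by rewrite mulr0n sub0r oppr_eq0 polyC_eq0; right.
have sizeV s u : {in V, s =1 s0} -> u \in V -> size (N u (s u)) = 1%N.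
  move=> sV uV; rewrite sV //; have [ub|ub] := boolP (u \in beta).
    by rewrite mxE ub eqxx size_poly1.
  have /s0V[A0 su] : u \in V :\: beta by rewrite inE ub.
  by rewrite NE // eq_sym (negPf su) mulr0n sub0r size_polyN size_polyC A0.
have sizeN s u : u \notin V -> (size (N u (s u)) <= (s u == u).+1)%N.
  move=> uV; rewrite NE; last by apply: contraNN uV; apply: (subsetP bV).
  rewrite eq_sym; case: eqP => [->|_]; first by rewrite mulr1n size_XsubC.
  by rewrite mulr0n sub0r size_polyN size_polyC_leq1.
have sizeT s : T s != 0 -> size (T s) = ((\sum_u size (N u (s u))).+1 - n)%N.
  move=> /prodf_neq0 Ts; rewrite size_prod => [|u _]; last exact: Ts.
  by rewrite card_ord.
have split s : {in V, s =1 s0} ->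
    (\sum_u size (N u (s u)) = #|V| + \sum_(u in ~: V) size (N u (s u)))%N.
  move=> sV; rewrite (bigID (mem V)) /= -sum1_card; congr (_ + _)%N.
    by apply: eq_bigr => u /(sizeV _ _ sV).
  by apply: eq_bigl => u; rewrite inE.
have cV : (#|V| + #|~: V| = n)%N by rewrite cardsC card_ord.
have T0 : T s0 != 0.
  apply/prodf_neq0 => u _; have [uV|uV] := boolP (u \in V).
    by rewrite -size_poly_gt0 sizeV.
  rewrite NE ?s0N // ?eqxx ?mulr1n ?polyXsubC_eq0 //.
  by apply: contraNN uV; apply: (subsetP bV).
have size0 : size (T s0) = (n - #|V|).+1.
  rewrite sizeT // split // (eq_bigr (fun=> 2%N)) => [|u]; last first.
    rewrite inE => uV; rewrite NE; last by apply: contraNN uV; apply: (subsetP bV).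
    by rewrite s0N // eqxx mulr1n size_XsubC.
  rewrite sum_nat_const; lia.
have sizeS s : s != s0 -> (size (T s) < size (T s0))%N.
  move=> ss0; have [->|Ts] := eqVneq (T s) 0.
    by rewrite size_poly0 size0.
  have sV := TV s Ts.
  (* Agreeing with [s0] on [V] but differing from it, [s] moves some [u] outside [V], and the factor
     at [u] loses its X. *)
  have [u uV su] : exists2 u, u \in ~: V & s u != u.
    apply/exists_inP; apply: contraR ss0 => /exists_inPn h.
    apply/eqP/permP => u; have [/sV//|uV] := boolP (u \in V).
    by rewrite s0N //; apply/eqP; rewrite -[_ == _]negbK h // inE.
  rewrite size0 sizeT // split // (bigD1 u) //=.
  have : (size (N u (s u)) <= 1)%N.
    by apply: leq_trans (sizeN s u _) _; rewrite ?(negPf su) // -in_setC.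
  have : (\sum_(i in ~: V | i != u) size (N i (s i)) <= \sum_(i in ~: V | i != u) 2)%N.
    apply: leq_sum => i /andP[]; rewrite inE => iV _.
    by apply: leq_trans (sizeN s i iV) _; case: (_ == _).
  have := cardsD1 u (~: V); rewrite uV.
  have -> : (\sum_(i in ~: V | i != u) 2 = #|~: V :\ u| * 2)%N.
    by rewrite -sum_nat_const; apply: eq_bigl => i; rewrite !inE andbC.
  move: cV (\sum_(i in _ | _) _)%N (size (N u _)) #|_ :\ u| => /=.
  move: #|V| #|~: V| => v c; lia.
rewrite /determinant (bigD1 s0) //= size_polyDl.
  by rewrite size_Msign.
rewrite size_Msign -/(T s0) size0 ltnS.
apply: leq_trans (size_sum _ _ _) _; apply/bigmax_leqP => s ss0.
by rewrite size_Msign -ltnS -size0 sizeS.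
Qed.

(** Evaluated at [x], the matrix differs from xI - A only in the rows of [beta], so its rank exceeds
    that of xI - A by at most [#|beta|]. *)
Lemma mup_det_routing_mx (F : fieldType) n (A : 'M[F]_n) beta s0 x :
  \det (routing_mx A beta s0) != 0 ->
  (n - \rank (x%:M - A)%R - #|beta| <= mup x (\det (routing_mx A beta s0)))%N.
Proof.
move=> D0; rewrite mup_geq //.
apply: dvdp_trans (rank_horner_dvd_det (routing_mx A beta s0) x).
rewrite dvdp_exp2l // -subnDA leq_sub2l //.
set N := map_mx _ _; rewrite -[N](subrK (x%:M - A)) addrC.
apply: leq_trans (mxrank_add _ _) _; rewrite leq_add2l.
apply: rank_le_nonzero_rows => u v ub.
rewrite !mxE (negPf ub) /horner_eval !hornerE hornerMn hornerX.
by rewrite subrr.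
Qed.

(** * Counting eigenvalues by multiplicity, and the two bounds *)

Lemma q_count (R : realType) n (A : 'M[R]_n) (s : seq R) j :
  char_poly A = \prod_(y <- s) ('X - y%:P) ->
  q_ j A = count (fun y => (j <= count_mem y s)%N) (undup s).
Proof.
move=> sE; rewrite /q_ -size_filter.
apply/perm_size/uniq_perm => [||y].
- exact: fset_uniq.
- by rewrite filter_uniq // undup_uniq.
rewrite cardinality.in_fset_set; last exact: finite_eigenvalues.
rewrite mem_filter mem_undup; apply/idP/andP; rewrite classical_sets.in_setE.
  by case; rewrite eigenvalue_root_char sE root_prod_XsubC mu_prod_XsubC.
case=> ys yj; split; first by rewrite eigenvalue_root_char sE root_prod_XsubC.
by rewrite sE mu_prod_XsubC.
Qed.

(** Double counting: an eigenvalue of multiplicity m is counted by [q_ j] exactly for j <= m, hence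
    min(m, t) times for j from 1 to t. *)
Lemma sum_q_count (R : realType) n (A : 'M[R]_n) (s : seq R) t :
  char_poly A = \prod_(y <- s) ('X - y%:P) ->
  (\sum_(1 <= j < t.+1) q_ j A = \sum_(y <- undup s) minn (count_mem y s) t)%N.
Proof.
move=> sE; under eq_bigr => j _ do rewrite (q_count j sE) -sum1_count big_mkcond.
rewrite exchange_big; apply: eq_bigr => y _ /=.
rewrite big_add1 /=; set m := count_mem y s.
elim: t => [|t IH]; first by rewrite big_geq // minn0.
rewrite big_nat_recr //= IH; case: ltnP; lia.
Qed.

Lemma rigid_linkage_le (R : realType) n (G : sgraph n) (A : 'M[R]_n) H :
  inS G A -> is_rigid G H ->
  (#|vset H| <= \sum_(1 <= j < (order_linkage H).+1) q_ j A)%N.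
Proof.
move=> [As AG] /rigid_linkage_routing[beta [s0 [<- bV s0G s0N s0U]]].
have [s [sn sE sr]] := realsym_spectrum As.
have Aadj u v : adj G u v -> A u v != 0.
  by move=> uv; rewrite AG //; apply: contraTneq uv => ->; rewrite adj_irr.
have := @size_det_routing_mx _ _ A (vset H) beta s0 bV.
set D := \det _ => sD.
have {}sD : size D = (n - #|vset H|).+1.
  apply: sD => // [u /s0G us|s1 s1b s1A]; first split.
  - exact: Aadj.
  - by apply: contraTneq us => ->; rewrite adj_irr.
  apply: s0U => // u /s1A[->|Au]; first by left.
  by have [->|us] := eqVneq (s1 u) u; [left | right; rewrite -AG // eq_sym].
have D0 : D != 0 by rewrite -size_poly_gt0 sD.
rewrite (sum_q_count _ sE).
(* The multiplicities of the eigenvalues as roots of [D] add up to at most the degree of [D]. *)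
have /= := sum_mup_le_deg D0 (undup_uniq s); rewrite sD /= => le1.
have le2 : (\sum_(y <- undup s) (count_mem y s - #|beta|) <= n - #|vset H|)%N.
  apply: leq_trans le1; apply: leq_sum => y _.
  apply: leq_trans (mup_det_routing_mx y D0); rewrite leq_sub2r //.
  by have := sr y; move: (\rank _) (count_mem y s) => r c; lia.
have nE : (\sum_(y <- undup s) count_mem y s = n)%N.
  rewrite -sn -sum1_size -[RHS]big_undup_iterop_count; apply: eq_bigr => y _.
  by rewrite Monoid.iteropE iter_addn_0 mul1n.
(* Each multiplicity m splits as min(m, t) plus the truncated difference m - t, with t =
   [#|beta|]. *)
have : (\sum_(y <- undup s) minn (count_mem y s) #|beta| +
        \sum_(y <- undup s) (count_mem y s - #|beta|) = n)%N.
  rewrite -big_split /= -[RHS]nE; apply: eq_bigr => y _.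
  by rewrite minnE subnK ?leq_subr.
have Vn : (#|vset H| <= n)%N by rewrite -[leqRHS]card_ord max_card.
move=> nsplit; rewrite -(leq_add2r (\sum_(y <- undup s) (count_mem y s - #|beta|))).
by rewrite [leqRHS]nsplit -[leqRHS](subnKC Vn) leq_add2l.
Qed.

Theorem theorem3p7 (R : realType) (n : nat) (G : sgraph n) (A : 'M[R]_n)
    (hA : inS G A) (t : nat) (ht : (0 < t)%N) :
  (RL G t <= \sum_(1 <= j < t.+1) q_ j A)%N /\
  Num.ceil ((RL G t)%:R / t%:R : rat) <= (q_graph R G)%:Z.
Proof.
have main (B : 'M[R]_n) : inS G B -> (RL G t <= \sum_(1 <= j < t.+1) q_ j B)%N.
  move=> hB; apply/bigmax_leqP => H /asboolP[Hr <-].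
  exact: rigid_linkage_le hB Hr.
split; first exact: main.
(* Some [B] attains the minimum, and the first bound is applied to it. Each of its distinct
   eigenvalues contributes min(m, t) <= t, so the sum is at most t times [q_mx B]. *)
rewrite /q_graph; case: ex_minnP => _ /asboolP[B hB <-] _.
have [s [_ sE _]] := realsym_spectrum hB.1.
rewrite ceil_le_int ler_pdivrMr ?ltr0n // -natrM ler_nat.
apply: leq_trans (main B hB) _; rewrite (sum_q_count _ sE) /q_mx (q_count _ sE).
rewrite (_ : count _ _ = size (undup s)).
  rewrite -sum1_size big_distrl /=; apply: leq_sum => y _.
  by rewrite mul1n geq_minr.
(* Every listed eigenvalue occurs at least once, so [q_ 1] counts them all. *)
apply/eqP; rewrite -all_count; apply/allP => y.
by rewrite mem_undup /= -has_pred1 has_count.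
Qed.
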